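(* Let $R_1=\mathbb{Z}_4[X,Y,Z]/M$, where $\mathbb{Z}_4=\mathbb{Z}/4\mathbb{Z}$ and $M$ is the ideal generated by $X^2-2,\ Y^2-2,\ Z^2,\ 2X,\ 2Y,\ 2Z,\ XY,\ XZ,\ YZ-2$. Let $n\ge 2$ and let $R_2,\ldots,R_n$ be non-zero reduced commutative rings with unity with $\chi(R_i)<\infty$ for $2\le i\le n$. Then $$\omega(R_1\times\cdots\times R_n)=5+\sum_{i=2}^n\omega(R_i)-(n-1),\qquad \chi(R_1\times\cdots\times R_n)=6+\sum_{i=2}^n\chi(R_i)-(n-1),$$ and consequently $$\omega(R_1\times\cdots\times R_n)<\chi(R_1\times\cdots\times R_n).$$
   Context: All rings are commutative with unity (not necessarily finite). A ring $R$ is regarded as a simple graph whose vertices are all elements of $R$ (including $0$), two distinct vertices $x,y$ being adjacent if and only if $xy=0$. The chromatic number $\chi(R)$ is the minimum number of colors needed to color the elements of $R$ so that adjacent elements receive distinct colors. The clique number $\omega(R)$ is the maximum size of a subset $C\subseteq R$ with $xy=0$ for all distinct $x,y\in C$. A ring is reduced if it has no non-zero nilpotent elements. *)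

(* Defs.v *)
From HB Require Import structures.
From mathcomp Require Import all_boot all_order all_algebra.
From mathcomp Require Import ring_quotient.
From mathcomp Require Import finmap mpoly.
From mathcomp Require Import boolp constructive_ereal.

Set Implicit Arguments.
Unset Strict Implicit.
Unset Printing Implicit Defensive.

Import Order.TTheory GRing.Theory Num.Theory.
Local Open Scope ring_scope.

Section ZeroProductGraph.
Variable R : comPzRingType.

Definition adj : rel R := [rel x y | (x != y) && (x * y == 0)].

Definition is_clique (C : {fset R}) : Prop :=
  {in C &, forall x y : R, x != y -> x * y = 0}.

Definition has_clique (k : nat) : Prop :=
  exists2 C : {fset R}, is_clique C & #|` C|%fset = k.

Definition colorable (k : nat) : Prop :=
  exists c : R -> 'I_k, forall x y : R, adj x y -> c x != c y.

Definition is_clique_number (k : nat) : Prop :=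
  has_clique k /\ forall j : nat, has_clique j -> (j <= k)%N.

Definition is_chromatic_number (k : nat) : Prop :=
  colorable k /\ forall j : nat, colorable j -> (k <= j)%N.

(* Both invariants live in the integers extended with infinities, so that the
   subtraction in the statement is not truncated; the value is +oo when finite
   cliques have unbounded size, resp. when no finite coloring exists. *)
Definition omega : \bar int :=
  if pselect (exists k, is_clique_number k) is left h
  then ((sval (cid h))%:Z)%:E else +oo%E.

Definition chi : \bar int :=
  if pselect (exists k, is_chromatic_number k) is left h
  then ((sval (cid h))%:Z)%:E else +oo%E.

Definition reduced : Prop :=
  forall (x : R) (k : nat), x ^+ k = 0 -> x = 0.

End ZeroProductGraph.

(* The product ring of a finite family, with componentwise operations. *)
Section ProductRing.
Variables (I : finType) (R : I -> comPzRingType).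
Local Notation P := {dffun forall i : I, R i}.
Implicit Types f g h : P.

Definition dffun_zero : P := [ffun i => 0].
Definition dffun_one : P := [ffun i => 1].
Definition dffun_opp f : P := [ffun i => - f i].
Definition dffun_add f g : P := [ffun i => f i + g i].
Definition dffun_mul f g : P := [ffun i => f i * g i].

Fact dffun_addA : associative dffun_add.
Proof. by move=> f g h; apply/ffunP=> i; rewrite !ffunE addrA. Qed.
Fact dffun_addC : commutative dffun_add.
Proof. by move=> f g; apply/ffunP=> i; rewrite !ffunE addrC. Qed.
Fact dffun_add0 : left_id dffun_zero dffun_add.
Proof. by move=> f; apply/ffunP=> i; rewrite !ffunE add0r. Qed.
Fact dffun_addN : left_inverse dffun_zero dffun_opp dffun_add.
Proof. by move=> f; apply/ffunP=> i; rewrite !ffunE addNr. Qed.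

HB.instance Definition _ := GRing.isZmodule.Build P
  dffun_addA dffun_addC dffun_add0 dffun_addN.

Fact dffun_mulA : associative dffun_mul.
Proof. by move=> f g h; apply/ffunP=> i; rewrite !ffunE mulrA. Qed.
Fact dffun_mulC : commutative dffun_mul.
Proof. by move=> f g; apply/ffunP=> i; rewrite !ffunE mulrC. Qed.
Fact dffun_mul1 : left_id dffun_one dffun_mul.
Proof. by move=> f; apply/ffunP=> i; rewrite !ffunE mul1r. Qed.
Fact dffun_mulDl : left_distributive dffun_mul +%R.
Proof. by move=> f g h; apply/ffunP=> i; rewrite !ffunE mulrDl. Qed.

HB.instance Definition _ := GRing.Zmodule_isComPzRing.Build P
  dffun_mulA dffun_mulC dffun_mul1 dffun_mulDl.
End ProductRing.

Definition gen_ideal (A : comNzRingType) (s : seq A) : {pred A} :=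
  fun p => `[< exists c : 'I_(size s) -> A, p = \sum_(i < size s) c i * s`_i >].

Section R1.
Local Notation A := {mpoly 'Z_4[3]}.
Local Notation X := ('X_(@Ordinal 3 0 isT) : A).
Local Notation Y := ('X_(@Ordinal 3 1 isT) : A).
Local Notation Z := ('X_(@Ordinal 3 2 isT) : A).

Definition M_gens : seq A :=
  [:: X ^+ 2 - 2; Y ^+ 2 - 2; Z ^+ 2;
      2 * X; 2 * Y; 2 * Z;
      X * Y; X * Z; Y * Z - 2].

Definition M : {pred A} := gen_ideal M_gens.

Fact M_idealr_closed : idealr_closed M.
Proof.
split.
- by apply/asboolP; exists (fun=> 0); rewrite big1 // => i _; rewrite mul0r.
- pose f : {rmorphism A -> 'Z_4} := meval (fun=> 0).
  have fX i : f 'X_i = 0 by exact: mevalXU.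
  apply/negP=> /asboolP[c] /(congr1 f).
  rewrite rmorph1 rmorph_sum => /(congr1 (fun z : 'Z_4 => 2 * z)).
  rewrite mulr_sumr big1 ?mulr1 // => i _.
  rewrite rmorphM mulrCA.
  suff -> : 2 * f M_gens`_i = 0 by rewrite mulr0.
  case: i => [[|[|[|[|[|[|[|[|[|i]]]]]]]]] hi] //=;
    rewrite ?rmorphB ?rmorphM ?rmorphXn ?rmorph_nat ?fX
            ?expr2 ?mul0r ?mulr0 ?sub0r //;
    by apply: val_inj.
move=> a p q /asboolP[c ->] /asboolP[d ->]; apply/asboolP.
exists (fun i => a * c i + d i); rewrite mulr_sumr -big_split /=.
by apply: eq_bigr => i _; rewrite mulrDl mulrA.
Qed.

HB.instance Definition _ := isIdealr.Build A M M_idealr_closed.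
End R1.

Definition R1 : comNzRingType := {ideal_quot M}.

(* Main.v *)
Require Import Defs.
From HB Require Import structures.
From mathcomp Require Import all_boot all_order all_algebra.
From mathcomp Require Import generic_quotient ring_quotient finmap mpoly boolp.
From mathcomp Require Import constructive_ereal.
From mathcomp Require Import ring.

Set Implicit Arguments.
Unset Strict Implicit.
Unset Printing Implicit Defensive.

Import Order.Theory GRing.Theory.
Local Open Scope ring_scope.

(** Every invariant involved is read off from one structure.  In a reduced ring S
with finite chromatic number, the non-zero members e_1, ..., e_k of a maximum
clique have prime annihilators with intersection 0 ([reduced_frame]): if s * t = 0
while s * e_i and t * e_i were both non-zero, these two elements could replace e_i
and enlarge the clique.  Giving a non-zero s the colour of the first e_i with
s * e_i != 0 is then a proper colouring, so omega(S) = chi(S) = k + 1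
([frame_clique_chromatic]).

Such families pass to finite products by placing each e_i in its own factor
([prod_frame]), so their sizes add up.  When S with a family of size k multiplies an
arbitrary ring R, elements with a non-zero component in S can be coloured with k
colours and contribute at most k members to a clique, while the elements (0, e_i)
are adjacent to each other and to all of R x 0.  Hence omega(R x S) = omega(R) + k
and chi(R x S) = chi(R) + k ([times_frame_clique], [times_frame_chromatic]).

There remain omega(R1) = 5 and chi(R1) = 6.  Put W = Y + Z.  Then X, Y, W are
pairwise orthogonal with square 2 and are killed by 2, so R1 is the 32-element ring
on Z_4 + F_2^3 whose product on F_2^3 is twice the standard dot product
([orthoclass_surj], [orthoclass_inj]).  There {0, 2, X, Y, W} is a clique.  Five
colours fail: all five are used on this clique, X + Y and X + Y + 2 take the colours
of X and Y, Y + W and Y + W + 2 those of Y and W, and X + Y + W, adjacent to these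
four elements and to 0 and 2, has no colour left
([orthoring_chromatic_number]).  Six colours suffice, and since a clique with six
elements would meet every class of the six-colouring, a look at its classes excludes
such cliques ([orthoring_clique_number]). *)

(** * Clique and chromatic numbers *)

Section Invariants.
Variable R : comPzRingType.

Lemma clique_number_unique k l :
  is_clique_number R k -> is_clique_number R l -> k = l.
Proof.
move=> [hk mk] [hl ml]; apply/eqP.
by rewrite eqn_leq (ml _ hk) (mk _ hl).
Qed.

Lemma chromatic_number_unique k l :
  is_chromatic_number R k -> is_chromatic_number R l -> k = l.
Proof.
move=> [hk mk] [hl ml]; apply/eqP.
by rewrite eqn_leq (ml _ hk) (mk _ hl).
Qed.

Lemma omegaE k : is_clique_number R k -> omega R = (k%:Z)%:E.
Proof.
move=> hk; rewrite /omega; case: pselect => [h|[]]; last by exists k.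
by rewrite (clique_number_unique (svalP (cid h)) hk).
Qed.

Lemma chiE k : is_chromatic_number R k -> chi R = (k%:Z)%:E.
Proof.
move=> hk; rewrite /chi; case: pselect => [h|[]]; last by exists k.
by rewrite (chromatic_number_unique (svalP (cid h)) hk).
Qed.

Lemma finite_chi_colorable : (chi R < +oo)%E -> exists k, colorable R k.
Proof.
rewrite /chi; case: pselect => [[k [hk _]] _|_]; last by rewrite ltxx.
by exists k.
Qed.

Lemma colorable_finType (K : finType) (c : R -> K) :
  (forall x y, adj x y -> c x != c y) -> colorable R #|K|.
Proof.
by move=> cP; exists (enum_rank \o c) => x y /cP; rewrite (inj_eq enum_rank_inj).
Qed.

Lemma clique_val (C : {fset R}) (x y : C) :
  is_clique C -> x != y -> val x * val y = 0.
Proof.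
move=> cC nxy; apply: cC; [exact: valP | exact: valP |].
by rewrite (inj_eq val_inj).
Qed.

Lemma coloring_inj_clique (C : {fset R}) (K : eqType) (c : R -> K) :
    is_clique C -> (forall x y, adj x y -> c x != c y) ->
  injective (fun x : C => c (val x)).
Proof.
move=> cC cP x y /eqP; apply: contraTeq => nxy; apply: cP.
have nv : val x != val y by rewrite (inj_eq val_inj).
by rewrite /adj /= nv clique_val ?eqxx.
Qed.

Lemma clique_le_coloring k j : has_clique R k -> colorable R j -> (k <= j)%N.
Proof.
move=> [C cC <-] [c cP]; have := leq_card _ (coloring_inj_clique cC cP).
by rewrite card_ord -cardfE.
Qed.

Lemma clique_number_eq_chromatic k : has_clique R k -> colorable R k ->
  is_clique_number R k /\ is_chromatic_number R k.
Proof.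
move=> hk ck; split; split=> // j hj; first exact: clique_le_coloring hj ck.
exact: clique_le_coloring hk hj.
Qed.

Lemma has_clique_finType (K : finType) (v : K -> R) :
    injective v -> (forall i j, i != j -> v i * v j = 0) ->
  has_clique R #|K|.
Proof.
move=> vI vP; exists [fset v i | i : K]%fset; last first.
  by rewrite card_imfset //= cardE.
move=> _ _ /imfsetP[i _ ->] /imfsetP[j _ ->] nij.
by apply: vP; apply: contraNneq nij => ->.
Qed.

Lemma maximum_clique j : colorable R j -> exists k, is_clique_number R k.
Proof.
move=> cj.
have ex0 : exists k, `[< has_clique R k >].
  by exists 0%N; apply/asboolP; exists fset0.
have ub k : `[< has_clique R k >] -> (k <= j)%N.
  by move=> /asboolP hk; exact: clique_le_coloring hk cj.
case: (ex_maxnP ex0 ub) => k /asboolP hk maxk; exists k; split=> // l hl.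
by apply: maxk; apply/asboolP.
Qed.

End Invariants.

(** * Invariance under bijections preserving zero products *)

Section Transfer.
Variables (R S : comPzRingType) (f : R -> S) (g : S -> R).
Hypotheses (fK : cancel f g) (gK : cancel g f).
Hypothesis f0 : forall x y, x * y = 0 <-> f x * f y = 0.

Lemma adj_transfer x y : adj (f x) (f y) = adj x y.
Proof.
rewrite /adj /= (can_eq fK); congr (_ && _).
by apply/eqP/eqP => /f0.
Qed.

Lemma colorable_transfer k : colorable R k <-> colorable S k.
Proof.
split=> [] [c cP].
  exists (c \o g) => x y; rewrite -{1}(gK x) -{1}(gK y) adj_transfer; exact: cP.
by exists (c \o f) => x y; rewrite -adj_transfer; exact: cP.
Qed.

Lemma has_clique_transfer k : has_clique R k <-> has_clique S k.
Proof.
split=> [] [C cC <-]; rewrite cardfE.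
  apply: (@has_clique_finType _ _ (fun x : C => f (val x))).
    by move=> x y /(can_inj fK)/val_inj.
  by move=> x y nxy; apply/(f0 (val x) (val y)); exact: clique_val.
apply: (@has_clique_finType _ _ (fun x : C => g (val x))).
  by move=> x y /(can_inj gK)/val_inj.
by move=> x y nxy; apply/f0; rewrite !gK; exact: clique_val.
Qed.

Lemma clique_number_transfer k : is_clique_number R k -> is_clique_number S k.
Proof.
by move=> [/has_clique_transfer hk mk]; split=> // j /has_clique_transfer/mk.
Qed.

Lemma chromatic_number_transfer k :
  is_chromatic_number R k -> is_chromatic_number S k.
Proof.
by move=> [/colorable_transfer hk mk]; split=> // j /colorable_transfer/mk.
Qed.

End Transfer.

(** * Families with prime annihilators *)

(** For finite K, the annihilators of the e i are the minimal primes of S, and their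
intersection is 0.  Primality is asked only at s * t = 0: if s * t * e i = 0, apply the clause to
s * e i and t, and use that S has no non-zero element of square 0. *)
Definition prime_frame (S : comPzRingType) (K : Type) (e : K -> S) : Prop :=
  [/\ forall i, e i != 0,
      forall i j, i <> j -> e i * e j = 0,
      forall s, (forall i, s * e i = 0) -> s = 0
    & forall i s t, s * t = 0 -> s * e i = 0 \/ t * e i = 0].

Section PrimeFrame.
Variables (S : comPzRingType) (K : finType) (e : K -> S).
Hypothesis frame_e : prime_frame e.

Lemma frame_inj : injective e.
Proof.
case: frame_e => e0 eM s0 _ i j eij; apply: contrapT => nij.
have /negP[] := e0 i; apply/eqP/s0 => l.
have [<-|nil] := EM (i = l); last exact: eM.
by rewrite {2}eij eM.
Qed.

Definition frame_color (s : S) : option K := [pick i | s * e i != 0].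

Lemma frame_colorN0 s : (frame_color s == None) = (s == 0).
Proof.
rewrite /frame_color; case: pickP => [i|s0] /=.
  by case: (eqVneq s 0) => // ->; rewrite mul0r eqxx.
case: frame_e => _ _ h _; apply/esym/eqP/h => i.
by apply/eqP/negbFE/s0.
Qed.

Lemma frame_colorP s t : s != 0 -> s * t = 0 -> frame_color s != frame_color t.
Proof.
rewrite -frame_colorN0 /frame_color.
case: pickP => // i si _ st; case: pickP => // j tj; apply: contraNneq si => -[ij].
case: frame_e => _ _ _ /(_ i _ _ st)[->//|ti].
by rewrite -ij ti eqxx in tj.
Qed.

(** The e i together with 0 form a clique, and 0 takes the colour None. *)
Lemma frame_clique_chromatic :
  is_clique_number S #|K|.+1 /\ is_chromatic_number S #|K|.+1.
Proof.
case: (frame_e) => e0 eM _ _; rewrite -card_option.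
apply: clique_number_eq_chromatic.
  apply: (@has_clique_finType _ _ (oapp e 0)).
    case=> [i|] [j|] //=; first by move/frame_inj->.
      by move=> /eqP; rewrite (negbTE (e0 i)).
    by move=> /esym/eqP; rewrite (negbTE (e0 j)).
  case=> [i|] [j|] //= nij; rewrite ?mul0r ?mulr0 //.
  by apply: eM; apply/eqP; apply: contraNneq nij => ->.
apply: (colorable_finType (c := frame_color)) => x y /andP[nxy /eqP xy0].
have [x0|x0] := eqVneq x 0; last exact: frame_colorP.
rewrite eq_sym; apply: frame_colorP; last by rewrite mulrC.
by rewrite -x0 eq_sym.
Qed.

End PrimeFrame.

(** * Reduced rings of finite chromatic number *)

Section BeckReduced.
Variable S : comPzRingType.
Hypothesis redS : reduced S.

Lemma reduced_sqr (x : S) : x * x = 0 -> x = 0.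
Proof. by move=> xx; apply: (redS (k := 2)); rewrite expr2. Qed.

Lemma clique_extend (C : {fset S}) (x : S) :
    is_clique C -> (forall y, y \in C -> x * y = 0) ->
  is_clique (x |` C)%fset.
Proof.
move=> cC xC y z /fset1UP[->|yC] /fset1UP[->|zC] nyz.
- by rewrite eqxx in nyz.
- exact: xC.
- by rewrite mulrC xC.
- exact: cC.
Qed.

(** Beck's theorem: a maximum clique consists of 0 and of elements with prime
annihilator, because an annihilator that is not prime lets the clique grow. *)
Lemma reduced_frame j : colorable S j ->
  exists C : {fset S}, prime_frame (fun x : C => val x).
Proof.
move=> /maximum_clique[k [[C cC Ck] maxk]].
have maxC (D : {fset S}) : is_clique D -> (#|` D| <= #|` C|)%N.
  by move=> cD; rewrite Ck; apply: maxk; exists D.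
have zC : 0 \in C.
  apply: contraT => zC.
  have /maxC : is_clique (0 |` C)%fset.
    by apply: clique_extend => // y _; rewrite mul0r.
  by rewrite cardfsU1 zC add1n ltnn.
pose D := (C `\ 0)%fset.
have DC x : x \in D -> (x != 0) && (x \in C) by rewrite in_fsetD1.
have CD : #|` C| = #|` D|.+1 by rewrite (cardfsD1 0 C) zC.
exists D; split=> /=.
- by move=> i; have /DC/andP[] := valP i.
- move=> i l nil; apply: cC; first by have /DC/andP[] := valP i.
    by have /DC/andP[] := valP l.
  by rewrite (inj_eq val_inj); apply/eqP.
- move=> s sD; have sC y : y \in C -> s * y = 0.
    have [->|y0 yC] := eqVneq y 0; first by rewrite mulr0.
    have yD : y \in D by rewrite in_fsetD1 y0.
    by have := sD [` yD]%fset.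
  apply: reduced_sqr; apply: (sC s); apply: contraT => nsC.
  have /maxC := clique_extend cC sC.
  by rewrite cardfsU1 nsC add1n ltnn.
move=> i s t st; apply: contrapT => /not_orP[/eqP se /eqP te].
(* s * x and t * x replace x: they are orthogonal, hence distinct as S is reduced. *)
set x := val i in se te *; have /DC/andP[x0 xC] : x \in D := valP i.
pose B := (D `\ x)%fset.
have DB : #|` D| = #|` B|.+1 by rewrite (cardfsD1 x D) (valP i).
have BP y : y \in B -> [/\ y != x, x * y = 0 & y \in C].
  rewrite in_fsetD1 => /andP[nyx /DC/andP[_ yC]]; split=> //.
  by apply: cC; rewrite // eq_sym.
(* A non-zero multiple of x squares to something non-zero, while it kills B. *)
have nB a : a * x != 0 -> a * x \notin B.
  move=> ax; apply: contra ax => /BP[_ xax _]; apply/eqP/reduced_sqr.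
  by rewrite -mulrA xax mulr0.
have cB : is_clique B.
  by move=> y z /BP[_ _ yC] /BP[_ _ wC]; apply: cC.
have orB a y : y \in B -> a * x * y = 0.
  by move=> /BP[_ xy _]; rewrite -mulrA xy mulr0.
have stx : s * x * (t * x) = 0 by rewrite mulrACA st mul0r.
have nst : s * x != t * x.
  by apply: contraNneq te => E; apply/eqP/reduced_sqr; rewrite -{1}E.
have zB : 0 \notin B by rewrite !in_fsetD1 eqxx andbF.
have cl : is_clique (0 |` (s * x |` (t * x |` B)))%fset.
  apply: clique_extend; last by move=> y _; rewrite mul0r.
  apply: clique_extend; last by move=> y /fset1UP[->//|]; exact: orB.
  by apply: clique_extend => // y; exact: orB.
have := maxC _ cl; rewrite CD DB !cardfsU1 !in_fset1U !negb_or nst (nB s) // (nB t) //.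
by rewrite zB ![0 == _]eq_sym se te !add1n ltnn.
Qed.

End BeckReduced.

(** * Products *)

Section ProductFrame.
Variables (I : finType) (S : I -> comPzRingType) (K : I -> finType).
Variable e : forall i, K i -> S i.
Hypothesis frame_e : forall i, prime_frame (@e i).

Definition single (i : I) (s : S i) : {dffun forall i, S i} :=
  [ffun l => if pselect (i = l) is left E then ecast l (S l) E s else 0].

Lemma single_mul i (s : S i) (x : {dffun forall i, S i}) :
  x * single s = single (x i * s).
Proof.
apply/ffunP => l; rewrite !ffunE; case: pselect => [E|_]; last by rewrite mulr0.
by case: l / E.
Qed.

Lemma single_at i (s : S i) : single s i = s.
Proof.
by rewrite ffunE; case: pselect => // E; rewrite (Prop_irrelevance E erefl).
Qed.

Lemma single_off i l (s : S i) : i <> l -> single s l = 0.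
Proof. by rewrite ffunE; case: pselect. Qed.

Lemma single0 i : single (0 : S i) = 0.
Proof. by apply/ffunP => l; rewrite !ffunE; case: pselect => // E; case: l / E. Qed.

Definition sum_frame (p : {i : I & K i}) : {dffun forall i, S i} :=
  single (e (tagged p)).

Lemma prod_frame : prime_frame sum_frame.
Proof.
split.
- move=> [i k]; case: (frame_e i) => /(_ k) e0 _ _ _.
  apply: contraNneq e0 => /(congr1 (fun x : {dffun _} => x i)).
  by rewrite single_at ffunE => ->.
- move=> [i k] [l m] nkm; rewrite /sum_frame /= single_mul.
  have [E|nil] := EM (i = l); last by rewrite single_off // mul0r single0.
  case: l / E m nkm => m nkm; case: (frame_e i) => _ eM _ _.
  by rewrite single_at eM ?single0 // => E; apply: nkm; rewrite E.
- move=> x xP; apply/ffunP => i; rewrite ffunE; case: (frame_e i) => _ _ + _.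
  apply=> k; rewrite -[LHS](single_at) -single_mul.
  by rewrite (xP (Tagged K k)) ffunE.
move=> [i k] x y xy; case: (frame_e i) => _ _ _.
move=> /(_ k (x i) (y i)); rewrite /sum_frame /= !single_mul.
case=> [|->|->]; rewrite ?single0; [|by left|by right].
by have := congr1 (fun x : {dffun _} => x i) xy; rewrite !ffunE.
Qed.

End ProductFrame.

Section TimesFrame.
Variables (R S : comPzRingType) (K : finType) (e : K -> S).
Hypothesis frame_e : prime_frame e.

Let fibre0 (x : R) : R * S := (x, 0).

Lemma mul_fibre0 (x y : R) : fibre0 x * fibre0 y = fibre0 (x * y).
Proof. by congr (_, _); rewrite /= mul0r. Qed.

(** The members of a clique with zero second component form a clique of R; the others
have distinct frame colours in K. *)
Lemma times_frame_clique w : is_clique_number R w ->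
  is_clique_number (R * S)%type (w + #|K|)%N.
Proof.
case: (frame_e) => e0 eM _ _ [[C cC <-] maxC]; split.
  rewrite cardfE -card_sum.
  pose v (p : C + K) : R * S :=
    match p with inl x => (val x, 0) | inr i => (0, e i) end.
  apply: (@has_clique_finType _ _ v).
    case=> [x|i] [y|j] //= []; first by move/val_inj->.
    - by move=> _ /esym/eqP; rewrite (negbTE (e0 j)).
    - by move=> _ /eqP; rewrite (negbTE (e0 i)).
    - by move/(frame_inj frame_e)->.
  case=> [x|i] [y|j] nij; congr (_, _); rewrite /= ?mul0r ?mulr0 //.
    by apply: clique_val => //; apply: contraNneq nij => ->.
  by apply: eM => E; rewrite E eqxx in nij.
move=> j [D cD <-].
pose p (x : D) : bool := (val x).2 == 0.
have fP (x : {x : D | p x}) : (val (val x)).2 = 0 by apply/eqP/(valP x).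
rewrite cardfE -(cardC p); apply: leq_add.
  rewrite -card_sig; apply: maxC.
  have inj (x y : {x : D | p x}) : (val (val x)).1 = (val (val y)).1 -> x = y.
    move=> E; do 2!apply: val_inj; rewrite /= [LHS]surjective_pairing.
    by rewrite [RHS]surjective_pairing E !fP.
  apply: (@has_clique_finType _ _ (fun x : {x : D | p x} => (val (val x)).1)) => //.
  move=> x y nxy; have xy0 : val (val x) * val (val y) = 0.
    by apply: clique_val => //; rewrite (inj_eq val_inj).
  exact: (congr1 fst xy0).
(* The colours of the members outside the fibre are distinct and none is None. *)
rewrite -card_sig -ltnS -!card_option.
pose q x := x \in predC p.
pose col (x : option {x : D | q x}) :=
  oapp (fun y => frame_color e (val (val y)).2) None x.
have qP (x : {x : D | q x}) : (val (val x)).2 != 0 := valP x.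
apply: (@leq_card _ _ col) => -[x|] [y|] //=; last first.
- by move=> /esym/eqP; rewrite frame_colorN0 // (negbTE (qP y)).
- by move=> /eqP; rewrite frame_colorN0 // (negbTE (qP x)).
move=> E; congr Some; apply/eqP; apply/negP => /negP nxy.
have xy0 : val (val x) * val (val y) = 0.
  by apply: clique_val => //; rewrite (inj_eq val_inj).
by have := frame_colorP frame_e (qP x) (congr1 snd xy0); rewrite E eqxx.
Qed.

(** For the lower bound, the colours of the (0, e i) are #|K| colours that a colouring
cannot reuse on R x 0, since each (0, e i) is adjacent to all of R x 0. *)
Lemma times_frame_chromatic k : is_chromatic_number R k ->
  is_chromatic_number (R * S)%type (k + #|K|)%N.
Proof.
case: (frame_e) => e0 eM _ _ [[c cP] minc]; split.
  rewrite -[k in (k + _)%N]card_ord -card_sum.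
  pose col (x : R * S) : 'I_k + K :=
    if frame_color e x.2 is Some i then inr i else inl (c x.1).
  apply: (colorable_finType (c := col)) => -[x s] [y t] /andP[nxy /eqP[xy st]].
  rewrite /col /=; have := frame_colorP frame_e (s := s) (t := t) _ st.
  case E : (frame_color e s) => [i|]; case F : (frame_color e t) => [l|] //=.
    by rewrite -(frame_colorN0 frame_e) E => /(_ isT); apply: contraNneq => -[->].
  move=> _; move/eqP: E; move/eqP: F; rewrite !frame_colorN0 // => /eqP t0 /eqP s0.
  have /cP : adj x y.
    rewrite /adj /= xy eqxx andbT; apply: contraNneq nxy => ->.
    by rewrite s0 t0.
  by apply: contraNneq => -[->].
move=> j [d dP].
pose A := [set a | `[< exists x, d (fibre0 x) = a >]].
pose B := [set d (0, e i) | i : K].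
have inA x : d (fibre0 x) \in A by rewrite inE; apply/asboolP; exists x.
have cA : (k <= #|A|)%N.
  rewrite -[#|A|]card_sig; apply: minc.
  apply: (colorable_finType (c := fun x => exist (fun a => a \in A) _ (inA x))).
  move=> x y /andP[nxy /eqP xy]; rewrite -(inj_eq val_inj) /=; apply: dP.
  rewrite /adj /= mul_fibre0 xy eqxx andbT.
  by apply: contraNneq nxy => -[->].
have cB : #|B| = #|K|.
  apply: card_imset => i l /eqP; apply: contraTeq => nil; apply: dP.
  apply/andP; split.
    by apply: contraNneq nil => -[/(frame_inj frame_e)->].
  by apply/eqP; congr (_, _); rewrite /= ?mul0r //; apply: eM; apply/eqP.
have AB : [disjoint A & B].
  apply/pred0P => a /=; apply/andP => -[]; rewrite inE => /asboolP[x <-].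
  move=> /imsetP[i _]; apply/eqP; apply: dP; apply/andP; split.
    by apply: contraNneq (e0 i) => -[_ <-].
  by apply/eqP; congr (_, _); rewrite /= ?mul0r ?mulr0.
rewrite -cB; apply: (leq_trans (leq_add cA (leqnn _))).
rewrite -cardsUI disjoint_setI0 // cards0 addn0.
by rewrite -[j in (_ <= j)%N]card_ord max_card.
Qed.

End TimesFrame.

(** * A model of R1 on Z_4 + F_2^3 *)

(** A tuple ((a0, a1), (b, c, d)) stands for a0 + 2 a1 + b X + c Y + d W, where X, Y, W
are killed by 2, pairwise orthogonal, and have square 2. *)
Definition orthoring : Type := ((bool * bool) * (bool * bool * bool))%type.
HB.instance Definition _ := Finite.on orthoring.

Section OrthoringOps.
Implicit Types s t u : orthoring.

Definition oelt (a0 a1 b c d : bool) : orthoring := ((a0, a1), (b, c, d)).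

Definition oadd s t : orthoring :=
  let: ((a0, a1), (b, c, d)) := s in let: ((a0', a1'), (b', c', d')) := t in
  oelt (a0 (+) a0') (a1 (+) a1' (+) (a0 && a0'))
       (b (+) b') (c (+) c') (d (+) d').

Definition oopp s : orthoring :=
  let: ((a0, a1), (b, c, d)) := s in oelt a0 (a0 (+) a1) b c d.

Definition omul s t : orthoring :=
  let: ((a0, a1), (b, c, d)) := s in let: ((a0', a1'), (b', c', d')) := t in
  oelt (a0 && a0')
       ((a0 && a1') (+) (a1 && a0') (+) (b && b') (+) (c && c') (+) (d && d'))
       ((a0 && b') (+) (b && a0')) ((a0 && c') (+) (c && a0'))
       ((a0 && d') (+) (d && a0')).

Definition oelts : seq orthoring :=
  let bs := [:: false; true] in
  [seq (a, v) | a <- [seq (x, y) | x <- bs, y <- bs],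
                v <- [seq (x, y) | x <- [seq (x, y) | x <- bs, y <- bs], y <- bs]].

Lemma oforall (p : pred orthoring) : all p oelts -> forall t, p t.
Proof.
by move=> /allP pP t; apply: pP; case: t => [[[] []] [[[] []] []]].
Qed.

Lemma oforall2 (p : orthoring -> pred orthoring) :
  all (fun s => all (p s) oelts) oelts -> forall s t, p s t.
Proof. by move=> h s t; exact: (oforall (oforall h s)). Qed.

Lemma oforall3 (p : orthoring -> orthoring -> pred orthoring) :
    all (fun s => all (fun t => all (p s t) oelts) oelts) oelts ->
  forall s t u, p s t u.
Proof. by move=> h s t u; exact: (oforall (oforall2 h s t)). Qed.

Fact oaddA : associative oadd.
Proof. by move=> s t u; apply/eqP; move: s t u; apply: oforall3; vm_compute. Qed.
Fact oaddC : commutative oadd.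
Proof. by move=> s t; apply/eqP; move: s t; apply: oforall2; vm_compute. Qed.
Fact oadd0 : left_id (oelt false false false false false) oadd.
Proof. by move=> s; apply/eqP; move: s; apply: oforall; vm_compute. Qed.
Fact oaddN : left_inverse (oelt false false false false false) oopp oadd.
Proof. by move=> s; apply/eqP; move: s; apply: oforall; vm_compute. Qed.

HB.instance Definition _ :=
  GRing.isZmodule.Build orthoring oaddA oaddC oadd0 oaddN.

Fact omulA : associative omul.
Proof. by move=> s t u; apply/eqP; move: s t u; apply: oforall3; vm_compute. Qed.
Fact omulC : commutative omul.
Proof. by move=> s t; apply/eqP; move: s t; apply: oforall2; vm_compute. Qed.
Fact omul1 : left_id (oelt true false false false false) omul.
Proof. by move=> s; apply/eqP; move: s; apply: oforall; vm_compute. Qed.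
Fact omulDl : left_distributive omul oadd.
Proof. by move=> s t u; apply/eqP; move: s t u; apply: oforall3; vm_compute. Qed.
Fact oone_neq0 : oelt true false false false false != 0.
Proof. by []. Qed.

HB.instance Definition _ := GRing.Zmodule_isComNzRing.Build orthoring
  omulA omulC omul1 omulDl oone_neq0.
End OrthoringOps.

(** * Identification of R1 with the model *)

Section ClassR1.
Local Notation A := {mpoly 'Z_4[3]}.
Local Notation X := ('X_(@Ordinal 3 0 isT) : A).
Local Notation Y := ('X_(@Ordinal 3 1 isT) : A).
Local Notation Z := ('X_(@Ordinal 3 2 isT) : A).

Definition classR1 : {rmorphism A -> R1} := \pi_R1%qT.

Lemma M_mem (i : 'I_(size M_gens)) : M_gens`_i \in M.
Proof.
apply/asboolP; exists (fun l => (l == i)%:R).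
rewrite (bigD1 i) //= eqxx mul1r big1 ?addr0 // => l /negbTE ->.
by rewrite mul0r.
Qed.

Lemma classR1_eq p q : classR1 p = classR1 q <-> p - q \in M.
Proof.
by rewrite Quotient.idealrBE; split=> /eqP.
Qed.

Lemma classR1_gen i : (i < size M_gens)%N -> classR1 M_gens`_i = 0.
Proof.
move=> hi; rewrite -(rmorph0 classR1); apply/classR1_eq; rewrite subr0.
exact: (M_mem (Ordinal hi)).
Qed.

Local Notation x := (classR1 X).
Local Notation y := (classR1 Y).
Local Notation w := (classR1 (Y + Z)).

Lemma R1_char : 2 * 2 = 0 :> R1.
Proof.
rewrite -(rmorph_nat classR1) -rmorphM -(rmorph0 classR1); congr (classR1 _).
rewrite -natrM -mpolyC_nat.
by rewrite (_ : (2 * 2)%:R = 0 :> 'Z_4) ?mpolyC0 //; apply: val_inj.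
Qed.
End ClassR1.

Section Presentation.
Local Notation A := {mpoly 'Z_4[3]}.
Local Notation X := ('X_(@Ordinal 3 0 isT) : A).
Local Notation Y := ('X_(@Ordinal 3 1 isT) : A).
Local Notation Z := ('X_(@Ordinal 3 2 isT) : A).
Local Notation x := (classR1 X).
Local Notation y := (classR1 Y).
Local Notation w := (classR1 (Y + Z)).

(** Replacing Z by W = Y + Z diagonalizes the products: Y * W = 2 + 2 = 0 and
W * W = 2 + 2 * 2 + 0 = 2. *)
Lemma R1_relations :
  [/\ [/\ 2 * x = 0, 2 * y = 0 & 2 * w = 0],
      [/\ x * x = 2, y * y = 2 & w * w = 2]
    & [/\ x * y = 0, x * w = 0 & y * w = 0]].
Proof.
have G i hi := @classR1_gen i hi.
have xx : x * x = 2.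
  by apply/subr0_eq; rewrite -[RHS](G 0%N isT) /= rmorphB rmorphXn rmorph_nat expr2.
have yy : y * y = 2.
  by apply/subr0_eq; rewrite -[RHS](G 1%N isT) /= rmorphB rmorphXn rmorph_nat expr2.
have zz : classR1 Z * classR1 Z = 0.
  by rewrite -[RHS](G 2%N isT) /= rmorphXn expr2.
have x2 : 2 * x = 0.
  by rewrite -[RHS](G 3%N isT) /= rmorphM rmorph_nat.
have y2 : 2 * y = 0.
  by rewrite -[RHS](G 4%N isT) /= rmorphM rmorph_nat.
have z2 : 2 * classR1 Z = 0.
  by rewrite -[RHS](G 5%N isT) /= rmorphM rmorph_nat.
have xy : x * y = 0.
  by rewrite -[RHS](G 6%N isT) /= rmorphM.
have xz : x * classR1 Z = 0.
  by rewrite -[RHS](G 7%N isT) /= rmorphM.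
have yz : y * classR1 Z = 2.
  by apply/subr0_eq; rewrite -[RHS](G 8%N isT) /= rmorphB rmorphM rmorph_nat.
rewrite (rmorphD classR1 Y Z); do 2!split=> //.
- by rewrite mulrDr y2 z2 addr0.
- have -> : (y + classR1 Z) * (y + classR1 Z) =
      y * y + 2 * (y * classR1 Z) + classR1 Z * classR1 Z by ring.
  by rewrite yy yz zz R1_char !addr0.
- by rewrite mulrDr xy xz addr0.
- by rewrite mulrDr yy yz -[2 in LHS]mulr1 -mulrDr R1_char.
Qed.

Definition orthopoly (t : orthoring) : A :=
  let: ((a0, a1), (b, c, d)) := t in
  a0%:R + 2 * a1%:R + b%:R * X + c%:R * Y + d%:R * (Y + Z).

Definition orthoclass (t : orthoring) : R1 := classR1 (orthopoly t).

Lemma orthoclassE t : orthoclass t =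
  let: ((a0, a1), (b, c, d)) := t in
  a0%:R + 2 * a1%:R + b%:R * x + c%:R * y + d%:R * w.
Proof.
rewrite /orthoclass; case: t => [[a0 a1] [[b c] d]] /=.
by rewrite !rmorphD !rmorphM !rmorph_nat -rmorphD.
Qed.

Lemma xor_torsion (u : R1) (b c : bool) : 2 * u = 0 ->
  (b (+) c)%:R * u = b%:R * u + c%:R * u.
Proof.
move=> u2; case: b; case: c; rewrite /= ?mul0r ?addr0 ?add0r //.
by rewrite -mulrDl u2.
Qed.

Lemma xor_twice (b c : bool) : 2 * (b (+) c)%:R = 2 * b%:R + 2 * c%:R :> R1.
Proof. by rewrite mulrC xor_torsion ?R1_char // ![_%:R * 2]mulrC. Qed.

Lemma orthoclassD : {morph orthoclass : s t / s + t}.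
Proof.
move=> [[a0 a1] [[b c] d]] [[a0' a1'] [[b' c'] d']]; rewrite [in LHS]/GRing.add /=.
rewrite !orthoclassE /oelt; have [[x2 y2 w2] _ _] := R1_relations.
rewrite !xor_torsion // !xor_twice.
have carry : a0%:R + a0'%:R = (a0 (+) a0')%:R + 2 * (a0 && a0')%:R :> R1.
  by case: a0; case: a0'; rewrite /= ?mulr0 ?mulr1 ?addr0 ?add0r.
transitivity ((a0 (+) a0')%:R + 2 * (a0 && a0')%:R + 2 * a1%:R + 2 * a1'%:R +
  (b%:R * x + b'%:R * x) + (c%:R * y + c'%:R * y) + (d%:R * w + d'%:R * w)).
  by ring.
by rewrite -carry; ring.
Qed.

Lemma orthoclassM : {morph orthoclass : s t / s * t}.
Proof.
move=> [[a0 a1] [[b c] d]] [[a0' a1'] [[b' c'] d']]; rewrite [in LHS]/GRing.mul /=.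
rewrite !orthoclassE /oelt; have [[x2 y2 w2] [xx yy ww] [xy xw yw]] := R1_relations.
rewrite !xor_torsion // !xor_twice -!mulnb !natrM.
set A0 : R1 := a0%:R; set A1 : R1 := a1%:R.
set A0' : R1 := a0'%:R; set A1' : R1 := a1'%:R.
set B : R1 := b%:R; set C : R1 := c%:R; set D : R1 := d%:R.
set B' : R1 := b'%:R; set C' : R1 := c'%:R; set D' : R1 := d'%:R.
(* Only the part of the expanded product not killed by the relations survives. *)
apply/esym; transitivity (A0 * A0' + 2 * (A0 * A1' + A1 * A0') + (x * x) * (B * B')
   + (y * y) * (C * C') + (w * w) * (D * D')
   + (A0 * B' + B * A0') * x + (A0 * C' + C * A0') * y + (A0 * D' + D * A0') * w
   + (2 * 2) * (A1 * A1')
   + (2 * x) * (A1 * B' + B * A1') + (2 * y) * (A1 * C' + C * A1')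
   + (2 * w) * (A1 * D' + D * A1')
   + (x * y) * (B * C' + C * B') + (x * w) * (B * D' + D * B')
   + (y * w) * (C * D' + D * C')).
  by ring.
by rewrite R1_char x2 y2 w2 xx yy ww xy xw yw; ring.
Qed.

Definition z4_orthoring (a : 'Z_4) : orthoring :=
  oelt (odd a) (odd a./2) false false false.

Fact z4_orthoring_zmod : zmod_morphism z4_orthoring.
Proof. by do 2!case=> [[|[|[|[|]]]]] //= ?; apply/eqP; vm_compute. Qed.

Fact z4_orthoring_monoid : monoid_morphism z4_orthoring.
Proof. by split=> //; do 2!case=> [[|[|[|[|]]]]] //= ?; apply/eqP; vm_compute. Qed.

HB.instance Definition _ :=
  GRing.isZmodMorphism.Build 'Z_4 orthoring z4_orthoring z4_orthoring_zmod.
HB.instance Definition _ :=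
  GRing.isMonoidMorphism.Build 'Z_4 orthoring z4_orthoring z4_orthoring_monoid.

Definition oX : orthoring := oelt false false true false false.
Definition oY : orthoring := oelt false false false true false.
Definition oW : orthoring := oelt false false false false true.

(** Z goes to W - Y, which is Y + W since 2 Y = 0. *)
Definition orthoeval : {rmorphism A -> orthoring} :=
  mmap z4_orthoring (fun i => nth 0 [:: oX; oY; oY + oW] i).

Lemma orthoeval_M p : p \in M -> orthoeval p = 0.
Proof.
move=> /asboolP[c ->]; rewrite rmorph_sum big1 // => i _; rewrite rmorphM.
suff -> : orthoeval M_gens`_i = 0 by rewrite mulr0.
case: i => [[|[|[|[|[|[|[|[|[|i]]]]]]]]] hi] //=;
  rewrite ?rmorphB ?rmorphM ?rmorphXn ?rmorph_nat /= ?mmapX ?mmap1U;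
  by apply/eqP; vm_compute.
Qed.

Lemma orthopolyK : cancel orthopoly orthoeval.
Proof.
case=> [[a0 a1] [[b c] d]]; rewrite /orthopoly !rmorphD !rmorphM !rmorph_nat.
rewrite rmorphD /= !mmapX !mmap1U.
by apply/eqP; case: a0; case: a1; case: b; case: c; case: d; vm_compute.
Qed.

(** Evaluation in the model vanishes on the ideal, so it separates the classes of the
polynomials that represent distinct elements of the model. *)
Lemma orthoclass_inj : injective orthoclass.
Proof.
move=> s t /classR1_eq /orthoeval_M /eqP.
by rewrite rmorphB !orthopolyK subr_eq0 => /eqP.
Qed.

(** The image is a subring containing the classes of all three variables. *)
Lemma orthoclass_surj r : exists t, orthoclass t = r.
Proof.
pose im r := exists t, orthoclass t = r.
have im0 : im 0 by exists 0; rewrite orthoclassE /= !mul0r mulr0 !addr0.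
have im1 : im 1 by exists 1; rewrite orthoclassE /= !mul0r mulr0 !addr0.
have imD u v : im u -> im v -> im (u + v).
  by move=> [s <-] [t <-]; exists (s + t); rewrite orthoclassD.
have imM u v : im u -> im v -> im (u * v).
  by move=> [s <-] [t <-]; exists (s * t); rewrite orthoclassM.
have imn k : im (k%:R).
  by elim: k => // k IH; rewrite -natr1; apply: imD.
have imX (i : 'I_3) : im (classR1 'X_i).
  have simpl := (mul0r, mulr0, mul1r, addr0, add0r).
  have imx : im x by exists oX; rewrite orthoclassE /= !simpl.
  have imy : im y by exists oY; rewrite orthoclassE /= !simpl.
  have imw : im w by exists oW; rewrite orthoclassE /= !simpl.
  have imz : im (classR1 Z).
    have [[_ y2 _] _ _] := R1_relations.
    have -> : classR1 Z = y + w.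
      by rewrite rmorphD addrA -mulr2n -mulr_natl y2 add0r.
    exact: imD.
  by case: i => [[|[|[|]]]].
have [p ->] : exists p, r = classR1 p.
  by exists (repr r); rewrite /= reprK.
elim/mpolyind: p => [|c m p _ _ IH]; first by rewrite rmorph0.
rewrite rmorphD; apply: imD => //; rewrite -mul_mpolyC rmorphM; apply: (imM _ _).
  rewrite -[c]natr_Zp mpolyC_nat rmorph_nat; exact: imn.
rewrite mpolyXE_id rmorph_prod; apply: (big_ind im) => // i _.
by rewrite rmorphXn; elim: (m i) => [|k IHk]; rewrite ?expr0 // exprS; apply: imM.
Qed.

End Presentation.

(** * Clique and chromatic number of R1 *)

Lemma orthoring_has_clique : has_clique orthoring 5.
Proof.
pose v (i : 'I_5) : orthoring := nth 0 [:: 0; 2; oX; oY; oW] i.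
rewrite -[5%N]card_ord; apply: (@has_clique_finType _ _ v).
  by do 2!case=> [[|[|[|[|[|]]]]]] // ?; move=> // _; exact: val_inj.
by do 2!case=> [[|[|[|[|[|]]]]]] // ?; move=> // _; apply/eqP; vm_compute.
Qed.

(** Units are adjacent only to 0, so they share the colour of 2.  The two lifts of a
non-zero isotropic vector (one with exactly two coordinates 1) are adjacent to each
other; they get two colours among those of the basis vectors that they are not
orthogonal to.  The vector X + Y + W needs the sixth colour. *)
Definition orthocolor (t : orthoring) : nat :=
  let: ((a0, a1), v) := t in
  if a0 then 1 else
  match v with
  | (false, false, false) => a1
  | (true, false, false) => 2
  | (false, true, false) => 3
  | (false, false, true) => 4
  | (true, true, false) => if a1 then 3 else 2
  | (false, true, true) => if a1 then 4 else 3
  | (true, false, true) => if a1 then 4 else 2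
  | (true, true, true) => 5
  end%N.

Lemma orthocolor_lt t : (orthocolor t < 6)%N.
Proof. by move: t; apply: oforall; vm_compute. Qed.

Definition ordcolor t : 'I_6 := Ordinal (orthocolor_lt t).

Lemma ordcolorP s t : adj s t -> ordcolor s != ordcolor t.
Proof.
apply/implyP; move: s t.
apply: (oforall2 (p := fun s t => adj s t ==> (orthocolor s != orthocolor t))).
by vm_compute.
Qed.

(** The class of colour 5 consists of the lifts of X + Y + W, which are orthogonal only to
the isotropic vectors, and two different non-zero isotropic vectors are never
orthogonal; each isotropic vector has lifts in only two of the classes 2, 3, 4. *)
Lemma orthocolor_rainbow s t u v :
    orthocolor s = 2 -> orthocolor t = 3 -> orthocolor u = 4 ->
    orthocolor v = 5 ->
  [|| s * t != 0, s * u != 0, t * u != 0, s * v != 0, t * v != 0 | u * v != 0].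
Proof.
move=> cs ct cu cv.
pose f k := [seq t <- oelts | orthocolor t == k].
have fP k r : orthocolor r = k -> r \in f k.
  by move=> <-; rewrite mem_filter eqxx /=; move: r; apply: oforall; vm_compute.
suff : all (fun v => all (fun u => all (fun t => all (fun s =>
    [|| s * t != 0, s * u != 0, t * u != 0, s * v != 0, t * v != 0 | u * v != 0])
  (f 2)) (f 3)) (f 4)) (f 5).
  by move=> /allP/(_ v (fP _ _ cv))/allP/(_ u (fP _ _ cu))/allP
    /(_ t (fP _ _ ct))/allP/(_ s (fP _ _ cs)).
by vm_compute.
Qed.

(** A clique with six elements meets each colour class exactly once. *)
Lemma orthoring_clique_number : is_clique_number orthoring 5.
Proof.
split=> [|j hj]; first exact: orthoring_has_clique.
have : (j <= 6)%N by apply: clique_le_coloring hj _; exists ordcolor; exact: ordcolorP.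
rewrite leq_eqVlt => /predU1P[j6|//]; case: hj => C cC Cj.
have cI := coloring_inj_clique cC ordcolorP.
have onto k : (k < 6)%N -> exists2 t, t \in C & orthocolor t = k.
  move=> k6; have /codomP[t /(congr1 val) /= E] :
      Ordinal k6 \in codom (fun t : C => ordcolor (val t)).
    by apply: inj_card_onto => //; rewrite card_ord -cardfE Cj j6.
  by exists (val t); [exact: valP|].
have [s sC cs] := onto 2%N isT; have [t tC ct] := onto 3%N isT.
have [u uC cu] := onto 4%N isT; have [v vC cv] := onto 5%N isT.
have orth p q : p \in C -> q \in C -> orthocolor p != orthocolor q -> p * q = 0.
  by move=> pC qC npq; apply: cC => //; apply: contraNneq npq => ->.
have := orthocolor_rainbow cs ct cu cv.
by rewrite !orth ?eqxx // ?cs ?ct ?cu ?cv.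
Qed.

Lemma two_colors (T : eqType) (p q u a b : T) :
  p \in [:: a; b] -> q \in [:: a; b] -> p != q -> u != p -> u != q ->
  u \notin [:: a; b].
Proof.
rewrite !inE => /orP[]/eqP-> /orP[]/eqP->; rewrite ?eqxx //=.
  by move=> _ /negbTE-> /negbTE->.
by move=> _ /negbTE-> /negbTE->.
Qed.

Lemma orthoring_chromatic_number : is_chromatic_number orthoring 6.
Proof.
split=> [|j [c cP]]; first by exists ordcolor; exact: ordcolorP.
rewrite leqNgt; apply/negP => j6.
(* With at most five colours, those of the clique 0, 2, X, Y, W are all of them. *)
have palette t : c t \in [:: c 0; c 2; c oX; c oY; c oW].
  apply: contraLR j6 => nt; rewrite -leqNgt.
  have u6 : uniq [:: c t; c 0; c 2; c oX; c oY; c oW].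
    by rewrite cons_uniq nt /= !inE !negb_or !cP.
  have := max_card (mem [:: c t; c 0; c 2; c oX; c oY; c oW]).
  by rewrite (card_uniqP u6) card_ord.
have cN s t : adj s t -> (c s == c t) = false by move/cP/negbTE.
(* u is adjacent to both lifts of X + Y and of Y + W, to 0 and to 2. *)
pose u := oX + oY + oW.
have uXY : c u \notin [:: c oX; c oY].
  apply: (@two_colors _ (c (oX + oY)) (c (oX + oY + 2))); rewrite ?cP //.
    by have := palette (oX + oY); rewrite !inE !(cN _ 0, cN _ 2, cN _ oW) // orbF.
  by have := palette (oX + oY + 2); rewrite !inE !(cN _ 0, cN _ 2, cN _ oW) // orbF.
have uYW : c u \notin [:: c oY; c oW].
  apply: (@two_colors _ (c (oY + oW)) (c (oY + oW + 2))); rewrite ?cP //.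
    by have := palette (oY + oW); rewrite !inE !(cN _ 0, cN _ 2, cN _ oX).
  by have := palette (oY + oW + 2); rewrite !inE !(cN _ 0, cN _ 2, cN _ oX).
have := palette u; rewrite !inE !(cN u 0, cN u 2) //=.
move: uXY uYW; rewrite !inE !negb_or => /andP[/negbTE-> /negbTE->].
by move=> /andP[_ /negbTE->].
Qed.

Lemma R1_invariants : is_clique_number R1 5 /\ is_chromatic_number R1 6.
Proof.
have sur r : {t | orthoclass t = r} by apply: cid; exact: orthoclass_surj.
pose inv r := sval (sur r).
have invK : cancel inv orthoclass by move=> r; exact: (svalP (sur r)).
have classK : cancel orthoclass inv by move=> t; apply: orthoclass_inj; exact: invK.
have c0 s t : s * t = 0 <-> orthoclass s * orthoclass t = 0.
  have zE : orthoclass 0 = 0 by rewrite orthoclassE /= !mul0r mulr0 !addr0.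
  by rewrite -orthoclassM -zE; split=> [->|/orthoclass_inj].
split.
  exact: (@clique_number_transfer orthoring R1 _ _ classK invK c0 _
    orthoring_clique_number).
exact: (@chromatic_number_transfer orthoring R1 _ _ classK invK c0 _
  orthoring_chromatic_number).
Qed.

(** * The invariants of the product *)

Local Open Scope ereal_scope.

(* For i : 'I_n.-1, the ring R i is the factor R_{i+2}. *)
Theorem mainTheorem7 (n : nat) (hn : (2 <= n)%N)
    (R : 'I_n.-1 -> comNzRingType)
    (hred : forall i : 'I_n.-1, reduced (R i))
    (hchi : forall i : 'I_n.-1, chi (R i) < +oo) :
  let P := (R1 * {dffun forall i : 'I_n.-1, R i})%type in
  [/\ omega P = (5%:Z)%:E + \sum_(i < n.-1) omega (R i) - ((n.-1)%:Z)%:E,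
      chi P = (6%:Z)%:E + \sum_(i < n.-1) chi (R i) - ((n.-1)%:Z)%:E
    & omega P < chi P].
Proof.
pose S i : comPzRingType := R i.
have frames i : {C : {fset S i} | prime_frame (fun x : C => val x)}.
  apply: cid; have [j cj] := finite_chi_colorable (hchi i).
  exact: (@reduced_frame (S i) (hred i) j cj).
pose C i := sval (frames i).
have frame_C i : prime_frame (fun x : C i => val x) := svalP (frames i).
have frame_prod := prod_frame frame_C.
have [clR1 chR1] := R1_invariants.
set N := #|{: {i : 'I_n.-1 & C i}}|.
have NE : (N%:Z = \sum_(i < n.-1) (#|{: C i}|.+1)%:Z - (n.-1)%:Z)%R.
  rewrite /N card_tagged sumnE big_map big_enum /=.
  under [in RHS]eq_bigr do rewrite -addn1 PoszD.
  rewrite big_split /= sumr_const card_ord natz addrK.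
  exact: (big_morph Posz PoszD (erefl _)).
have omE i : omega (R i) = ((#|{: C i}|.+1)%:Z)%:E.
  by apply: omegaE; have [] := frame_clique_chromatic (frame_C i).
have chE i : chi (R i) = ((#|{: C i}|.+1)%:Z)%:E.
  by apply: chiE; have [] := frame_clique_chromatic (frame_C i).
have omP := omegaE (times_frame_clique frame_prod clR1).
have chP := chiE (times_frame_chromatic frame_prod chR1).
move=> P; split.
- by rewrite omP (eq_bigr _ (fun i _ => omE i)) sumEFin -EFinN -!EFinD PoszD NE addrA.
- by rewrite chP (eq_bigr _ (fun i _ => chE i)) sumEFin -EFinN -!EFinD PoszD NE addrA.
by rewrite omP chP lte_fin ltz_nat ltn_add2r.
Qed.
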